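(* Consider synchronous federated Q-learning with $K$ agents, synchronization period $E$, time-invariant stepsize $\lambda>0$, $T$ iterations, discount factor $\gamma\in(0,1)$, rewards $R(s,a)\in[0,1]$, and initialization $Q_0$ with $0\le Q_0(s,a)\le \frac{1}{1-\gamma}$ for all $(s,a)\in\mathcal S\times\mathcal A$. Suppose $$E-1\le \frac{1}{\lambda}\min\Big\{\frac{1-\gamma}{4\gamma},\frac1K\Big\}\quad\text{and}\quad \lambda\le\frac1E .$$ Then for any $\delta\in(0,\frac13)$, with probability at least $1-3\delta$, $$\|\Delta_T\|_\infty\le \frac{4}{(1-\gamma)^2}\exp\Big\{-\frac12\sqrt{(1-\gamma)\lambda T}\Big\}+\frac{14\gamma^2}{(1-\gamma)^2}\lambda(E-1)\kappa+\frac{16}{(1-\gamma)^2}\sqrt{\frac{\lambda}{K}\log\frac{|\mathcal S||\mathcal A|KT}{\delta}} .$$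
   Context: Setting. $\mathcal S,\mathcal A$ are finite state and action sets, $\gamma\in(0,1)$, $R:\mathcal S\times\mathcal A\to[0,1]$. There are $K\ge1$ agents; agent $k$ has the MDP $\langle\mathcal S,\mathcal A,\mathcal P^k,\gamma,R\rangle$ with transition kernel $P^k(\cdot\mid s,a)$. The global kernel is $\bar P(s'\mid s,a)=\frac1K\sum_{k=1}^K P^k(s'\mid s,a)$. The transition heterogeneity is $\kappa=\sup_{k,s,a}\|\bar P(\cdot\mid s,a)-P^k(\cdot\mid s,a)\|$, where the row vector is measured in the induced (operator) $\infty$-norm of a $1\times|\mathcal S|$ matrix, i.e. $\sum_{s'}|\bar P(s'\mid s,a)-P^k(s'\mid s,a)|$. $Q^*$ is the optimal Q-function of the global MDP $\langle\mathcal S,\mathcal A,\bar{\mathcal P},\gamma,R\rangle$, i.e. the unique solution of $Q^*(s,a)=R(s,a)+\gamma\sum_{s'}\bar P(s'\mid s,a)\max_{a'}Q^*(s',a')$. Algorithm (synchronous federated Q-learning, integers $E,T\ge1$, stepsize $\lambda$, initial $Q_0\in\mathbb R^{|\mathcal S||\mathcal A|}$). Set $Q_0^k=Q_0$ for all $k$. At each iteration $t=0,1,\dots,T-1$, every agent $k$ draws, for every $(s,a)$, a sample $s_t^k(s,a)\sim P^k(\cdot\mid s,a)$, all samples being independent across $(s,a)$, $t$ and $k$, and computes $Q^k_{t+1/2}(s,a)=(1-\lambda)Q^k_t(s,a)+\lambda\big(R(s,a)+\gamma\max_{a'}Q^k_t(s_t^k(s,a),a')\big)$. If $(t+1)\bmod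 E=0$, then $Q^k_{t+1}=\frac1K\sum_{j=1}^K Q^j_{t+1/2}$ for all $k$; otherwise $Q^k_{t+1}=Q^k_{t+1/2}$. Notation: $\bar Q_t=\frac1K\sum_{k=1}^K Q_t^k$ and $\Delta_t=Q^*-\bar Q_t$. $\|\cdot\|_\infty$ of a vector is its maximum absolute entry. *)

(* Defs.v *)
From mathcomp Require Export all_boot all_order all_algebra.
From mathcomp Require Export all_classical all_reals all_analysis.
Export Order.TTheory GRing.Theory Num.Theory.
Export numFieldNormedType.Exports.

Set Implicit Arguments.
Unset Strict Implicit.
Unset Printing Implicit Defensive.

Local Open Scope classical_set_scope.
Local Open Scope ring_scope.

(* For a nonempty finite type the supremum of the range is attained, so this is
   the maximum; unlike a big operator with neutral element 0 it is also correct
   for negative values. *)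
Definition fmax (R : realType) (A : finType) (f : A -> R) : R := sup (range f).

Definition norm_infty (R : realType) (S A : finType) (q : S -> A -> R) : R :=
  \big[Num.max/0]_(x : S * A) `|q x.1 x.2|.

Definition transition_kernel (R : realType) (S A : finType)
    (p : S -> A -> S -> R) : Prop :=
  forall s a, (forall s', 0 <= p s a s') /\ \sum_s' p s a s' = 1.

Definition avg_kernel (R : realType) (S A : finType) (K : nat)
    (P : 'I_K -> S -> A -> S -> R) (s : S) (a : A) (s' : S) : R :=
  K%:R^-1 * \sum_(k < K) P k s a s'.

Definition heterogeneity (R : realType) (S A : finType) (K : nat)
    (P : 'I_K -> S -> A -> S -> R) : R :=
  \big[Num.max/0]_(x : 'I_K * S * A)
    \sum_s' `|avg_kernel P x.1.2 x.2 s' - P x.1.1 x.1.2 x.2 s'|.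

Definition bellman_optimal (R : realType) (S A : finType) (gamma : R)
    (rwd : S -> A -> R) (p : S -> A -> S -> R) (q : S -> A -> R) : Prop :=
  forall s a, q s a = rwd s a + gamma * \sum_s' p s a s' * fmax (q s').

Definition local_step (R : realType) (S A : finType) (gamma lambda : R)
    (rwd : S -> A -> R) (q : S -> A -> R) (next : S -> A -> S)
    (s : S) (a : A) : R :=
  (1 - lambda) * q s a + lambda * (rwd s a + gamma * fmax (q (next s a))).

(* [x t k s a] is the next state drawn by agent k at iteration t for the pair
   (s, a); [fedQ ... x t k] is the local table $Q_t^k$. *)
Fixpoint fedQ (R : realType) (S A : finType) (K E : nat) (gamma lambda : R)
    (rwd Q0 : S -> A -> R) (x : nat -> 'I_K -> S -> A -> S)
    (t : nat) (k : 'I_K) {struct t} : S -> A -> R :=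
  if t is t'.+1 then
    let half (j : 'I_K) :=
      local_step gamma lambda rwd (fedQ E gamma lambda rwd Q0 x t' j) (x t' j) in
    if (t'.+1 %% E == 0)%N
    then fun s a => K%:R^-1 * \sum_(j < K) half j s a
    else half k
  else Q0.

Definition fedQ_avg (R : realType) (S A : finType) (K E : nat)
    (gamma lambda : R) (rwd Q0 : S -> A -> R)
    (x : nat -> 'I_K -> S -> A -> S) (t : nat) (s : S) (a : A) : R :=
  K%:R^-1 * \sum_(k < K) fedQ E gamma lambda rwd Q0 x t k s a.

(* A finite state space carries the discrete sigma-algebra. *)
Definition discrete_rv (d : measure_display) (Omega : measurableType d)
    (S : finType) (X : Omega -> S) : Prop :=
  forall B : set S, measurable (X @^-1` B).

Definition has_law (d : measure_display) (Omega : measurableType d)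
    (R : realType) (Pr : probability Omega R) (S : finType)
    (X : Omega -> S) (p : S -> R) : Prop :=
  forall s, Pr (X @^-1` [set s]) = (p s)%:E.

Definition mutually_independent (d : measure_display)
    (Omega : measurableType d) (R : realType) (Pr : probability Omega R)
    (I S : finType) (X : I -> Omega -> S) : Prop :=
  forall (J : {set I}) (B : I -> set S),
    Pr (\bigcap_(i in [set` J]) (X i @^-1` B i)) =
    (\prod_(i in J) Pr (X i @^-1` B i))%E.

(* Main.v *)
(* The error of the averaged table obeys Delta_{t+1} = (1 - lambda) Delta_t +
   lambda gamma (noise_t + avg_k (V^*(x) - V_t^k(x))), where the noise
   avg_k (P^k V^* - V^*(x)) involves the deterministic V^* only, so its
   (1 - lambda)-discounted sum is a linear form in independent centered bounded
   variables.  Between synchronizations each local table obeys the same recursion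
   with the extra bias lambda gamma (Pbar - P^k) V^*; since lambda (E - 1) is at
   most (1 - gamma)/(4 gamma) and 1/K, it drifts from the last synchronized error
   by at most 4/3 (lambda gamma (E - 1) kappa / (1 - gamma) + N), where N bounds
   the local noise.  Subtracting the noise processes leaves a contraction with
   delay at most E - 1, whose homogeneous part decays like
   (1 - (1 - gamma) lambda / 2)^t.  The noise is controlled by Hoeffding's
   inequality under the product law of all samples, with variance proxy
   gamma^2 lambda / (K (1 - gamma)^2) for averaged and local noise alike, and a
   union bound. *)
Require Import Defs.
From mathcomp Require Import ring lra.

Set Implicit Arguments.
Unset Strict Implicit.
Unset Printing Implicit Defensive.

Local Open Scope classical_set_scope.
Local Open Scope ring_scope.

(** * The maximum over a finite type *)

Section Fmax.
Context {R : realType} {A : finType}.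
Implicit Types f g : A -> R.

Lemma fmax_ge f a : f a <= fmax f.
Proof.
apply: ub_le_sup; last by exists a.
exists (\sum_b `|f b|) => _ [b _ <-]; apply: le_trans (ler_norm _) _.
by rewrite (bigD1 b) //= lerDl sumr_ge0.
Qed.

Lemma fmax_le f c : (0 < #|A|)%N -> (forall a, f a <= c) -> fmax f <= c.
Proof.
move=> /card_gt0P[a0 _] fc; apply: ge_sup; first by exists (f a0), a0.
by move=> _ [a _ <-].
Qed.

Lemma fmax_dist f g c :
  (0 < #|A|)%N -> (forall a, `|f a - g a| <= c) -> `|fmax f - fmax g| <= c.
Proof.
move=> A0 fgc; rewrite ler_norml lerBlDr lerNl opprB lerBlDr; apply/andP; split;
  apply: fmax_le => // a.
- have := fmax_ge f a; have := fgc a; rewrite ler_norml => /andP[]; lra.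
- have := fmax_ge g a; have := fgc a; rewrite ler_norml => /andP[]; lra.
Qed.

End Fmax.

(** * Exponential moments and Hoeffding's inequality for finite product laws *)

Section Hoeffding.
Context {R : realType}.

(** For [x >= 1/2], [2 x^2] dominates [x]; below that, [1 + y <= exp y] at [x] and [-x] bounds the
    left side by [1 / (1 - x^2)], and [(1 - x^2)(1 + 2 x^2) >= 1]. The constant 2 instead of the
    sharp 1/2 keeps this elementary and leads to the 8 in the tail exponent. *)
Lemma cosh_le_expR_sqr (x : R) :
  (expR x + expR (- x)) / 2 <= expR (2 * x ^+ 2).
Proof.
wlog x0 : x / 0 <= x => [hw|].
  have [/hw//|/ltW x0] := leP 0 x.
  by rewrite addrC -(sqrrN x) -{2}(opprK x); apply: hw; rewrite oppr_ge0.
have [xbig|xsmall] := leP (2^-1) x.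
  have h1 : expR x <= expR (2 * x ^+ 2) by rewrite ler_expR; nra.
  have h2 : expR (- x) <= expR (2 * x ^+ 2).
    by rewrite ler_expR; apply: (le_trans (y := 0)); rewrite ?oppr_le0 ?mulr_ge0 ?sqr_ge0.
  lra.
have y0 : 0 < 1 - x ^+ 2 by nra.
apply: (@le_trans _ _ (1 - x ^+ 2)^-1).
  have hp : expR x <= (1 - x)^-1.
    rewrite -(invrK (expR x)) -expRN lef_pV2 ?posrE ?expR_gt0 //; last lra.
    exact: expR_ge1Dx.
  have hm : expR (- x) <= (1 + x)^-1.
    by rewrite expRN lef_pV2 ?posrE ?expR_gt0 ?expR_ge1Dx //; lra.
  have -> : (1 - x ^+ 2)^-1 = ((1 - x)^-1 + (1 + x)^-1) / 2.
    by field; apply/and3P; split; rewrite gt_eqF //; lra.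
  lra.
rewrite -[leLHS]mulr1 ler_pdivrMl //.
apply: (@le_trans _ _ ((1 - x ^+ 2) * (1 + 2 * x ^+ 2))).
  by have : 0 <= x ^+ 2 <= 4^-1; [apply/andP; split; nra | nra].
by rewrite ler_wpM2l ?expR_ge1Dx // ltW.
Qed.

(* Convexity of exp on [-c, c] replaces x by the two-point law with the same
   mean; the chord has value cosh c at 0. *)
Lemma mgf_bounded_centered (S : finType) (p g : S -> R) (c : R) :
  (forall s, 0 <= p s) -> \sum_s p s = 1 -> \sum_s p s * g s = 0 ->
  (forall s, `|g s| <= c) ->
  \sum_s p s * expR (g s) <= expR (2 * c ^+ 2).
Proof.
move=> p0 p1 pg0 gc.
have [s0 _|S0] := pickP (@predT S); last first.
  by move/esym/eqP: p1; rewrite big_pred0 // oner_eq0.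
have c0 : 0 <= c by apply: le_trans (gc s0).
have [c_eq0|c_neq0] := eqVneq c 0.
  rewrite c_eq0 expr0n mulr0 expR0 -p1; apply: ler_sum => s _.
  by have := gc s; rewrite c_eq0 normr_le0 => /eqP ->; rewrite expR0 mulr1.
have cgt0 : 0 < c by rewrite lt_def c_neq0.
apply: le_trans (cosh_le_expR_sqr c).
pose sh := (expR c - expR (- c)) / (2 * c).
have chord s : expR (g s) <= (expR c + expR (- c)) / 2 + sh * g s.
  have /andP[gl gu] : (- c <= g s <= c) by rewrite -ler_norml.
  pose t := (g s + c) / (2 * c).
  have t01 : 0 <= t <= 1.
    by rewrite divr_ge0 ?ler_pdivrMr ?mul1r /=; lra.
  have t0 : (0 <= t)%R by case/andP: t01.
  have t1 : (t <= 1)%R by case/andP: t01.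
  have := convex_expR (Itv01 t0 t1) c (- c).
  rewrite !convRE /= /unstable.onem => h.
  apply: le_trans (le_trans h _).
    by rewrite ler_expR le_eqVlt; apply/orP; left; apply/eqP; rewrite /t; field.
  by rewrite le_eqVlt; apply/orP; left; apply/eqP; rewrite /t /sh; field.
apply: (@le_trans _ _ (\sum_s p s * ((expR c + expR (- c)) / 2 + sh * g s))).
  by apply: ler_sum => s _; rewrite ler_wpM2l.
under eq_bigr do rewrite mulrDr (mulrCA _ sh).
by rewrite big_split /= -mulr_suml p1 mul1r -mulr_sumr pg0 mulr0 addr0.
Qed.

Section Product.
Context {I S : finType} (p : I -> S -> R).
Hypothesis p_ge0 : forall i s, 0 <= p i s.
Hypothesis p_sum1 : forall i, \sum_s p i s = 1.

Definition prod_weight (f : {ffun I -> S}) : R := \prod_i p i (f i).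

Lemma prod_weight_ge0 f : 0 <= prod_weight f.
Proof. exact: prodr_ge0. Qed.

Lemma sum_prod_weight : \sum_f prod_weight f = 1.
Proof. by rewrite -bigA_distr_bigA big1. Qed.

(** Chernoff's method: the indicator is dominated by an exponential, whose expectation factors over
    coordinates under the product law. *)
Lemma hoeffding_upper (g : I -> S -> R) (c : I -> R) (v eps : R) :
  (forall i, \sum_s p i s * g i s = 0) -> (forall i s, `|g i s| <= c i) ->
  \sum_i c i ^+ 2 <= v -> 0 < v -> 0 < eps ->
  \sum_(f : {ffun I -> S} | eps < \sum_i g i (f i)) prod_weight f
    <= expR (- (eps ^+ 2 / (8 * v))).
Proof.
(* [th] minimizes [2 th^2 v - th eps]; the minimum is [- eps^2 / (8 v)]. *)
move=> pg0 gc cv v0 e0; pose th := eps / (4 * v).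
have th0 : 0 < th by rewrite divr_gt0 // mulr_gt0.
apply: (@le_trans _ _
    (\sum_(f : {ffun I -> S}) prod_weight f * expR (th * (\sum_i g i (f i) - eps)))).
  rewrite big_mkcond /=; apply: ler_sum => f _; case: ifPn => [fe|_].
    rewrite -[leLHS]mulr1 ler_wpM2l ?prod_weight_ge0 //.
    by rewrite -expR0 ler_expR mulr_ge0 ?ltW // subr_gt0.
  by rewrite mulr_ge0 ?prod_weight_ge0 ?expR_ge0.
have -> : \sum_(f : {ffun I -> S}) prod_weight f * expR (th * (\sum_i g i (f i) - eps))
    = expR (- (th * eps)) * \prod_i \sum_s p i s * expR (th * g i s).
  rewrite bigA_distr_bigA mulr_sumr; apply: eq_bigr => f _.
  by rewrite big_split /= -expR_sum -mulr_sumr mulrBr expRD -/(prod_weight f); ring.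
apply: (@le_trans _ _ (expR (- (th * eps)) * expR (2 * th ^+ 2 * v))).
  rewrite ler_wpM2l ?expR_ge0 //.
  apply: (@le_trans _ _ (\prod_i expR (2 * (th * c i) ^+ 2))).
    apply: ler_prod => i _; apply/andP; split.
      by apply: sumr_ge0 => s _; rewrite mulr_ge0 ?expR_ge0.
    apply: mgf_bounded_centered => // [|s].
      under eq_bigr do rewrite mulrCA.
      by rewrite -mulr_sumr pg0 mulr0.
    by rewrite normrM gtr0_norm // ler_wpM2l // ltW.
  rewrite -expR_sum ler_expR.
  under eq_bigr do rewrite exprMn mulrA.
  by rewrite -mulr_sumr ler_wpM2l // mulr_ge0 // sqr_ge0.
by rewrite -expRD ler_expR le_eqVlt; apply/orP; left; apply/eqP;
  rewrite /th; field; rewrite gt_eqF.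
Qed.

Lemma hoeffding (g : I -> S -> R) (c : I -> R) (v eps : R) :
  (forall i, \sum_s p i s * g i s = 0) -> (forall i s, `|g i s| <= c i) ->
  \sum_i c i ^+ 2 <= v -> 0 < v -> 0 < eps ->
  \sum_(f : {ffun I -> S} | eps < `|\sum_i g i (f i)|) prod_weight f
    <= 2 * expR (- (eps ^+ 2 / (8 * v))).
Proof.
move=> pg0 gc cv v0 e0.
have up := hoeffding_upper pg0 gc cv v0 e0.
have lo : \sum_(f : {ffun I -> S} | eps < \sum_i - g i (f i)) prod_weight f
    <= expR (- (eps ^+ 2 / (8 * v))).
  apply: (hoeffding_upper (g := fun i s => - g i s)) cv v0 e0 => [i|i s].
    under eq_bigr do rewrite mulrN.
    by rewrite sumrN pg0 oppr0.
  by rewrite normrN.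
apply: le_trans (_ : _ <= _ + _) _; last by rewrite mulr_natl mulr2n; exact: lerD up lo.
rewrite big_mkcond [X in _ <= X + _]big_mkcond [X in _ <= _ + X]big_mkcond.
rewrite -big_split /=; apply: ler_sum => f _; rewrite sumrN ltr_normr.
have := prod_weight_ge0 f.
by do 2!case: (_ < _) => /=; lra.
Qed.

End Product.
End Hoeffding.

(** * A priori bounds on the optimal Q-function *)

Section Bellman.
Context {R : realType} {S A : finType}.
Variables (gamma : R) (rwd : S -> A -> R) (p : S -> A -> S -> R).
Variable q : S -> A -> R.
Hypotheses (S_gt0 : (0 < #|S|)%N) (A_gt0 : (0 < #|A|)%N).
Hypotheses (gamma_ge0 : 0 <= gamma) (gamma_lt1 : gamma < 1).
Hypothesis rwd01 : forall s a, 0 <= rwd s a <= 1.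
Hypothesis p_kernel : transition_kernel p.
Hypothesis q_opt : bellman_optimal gamma rwd p q.

Lemma kernel_average_bounds (v : S -> R) (l u : R) s a :
  (forall s', l <= v s' <= u) -> l <= \sum_s' p s a s' * v s' <= u.
Proof.
move=> vlu; have [p0 p1] := p_kernel s a.
rewrite -[l]mul1r -[u]mul1r -p1 !mulr_suml; apply/andP; split;
  by apply: ler_sum => s' _; rewrite ler_wpM2l //; case/andP: (vlu s').
Qed.

(** The Bellman equation at a minimizing pair gives [m >= gamma m], and at a maximizing pair
    [M <= 1 + gamma M]. *)
Lemma bellman_optimal_bounds s a : 0 <= q s a <= (1 - gamma)^-1.
Proof.
have g1 : 0 < 1 - gamma by rewrite subr_gt0.
have [s0 _] := card_gt0P S_gt0; have [a0 _] := card_gt0P A_gt0.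
pose F (x : S * A) := q x.1 x.2.
have [xm _ Fm] := @arg_minP _ _ _ (s0, a0) predT F isT.
have [xM _ FM] := @arg_maxP _ _ _ (s0, a0) predT F isT.
have fmaxF s' : F xm <= fmax (q s') <= F xM.
  apply/andP; split; last by apply: fmax_le => // a'; apply: (FM (s', a')).
  exact: le_trans (Fm (s', a0) isT) (fmax_ge (q s') a0).
apply/andP; split.
  apply: le_trans (Fm (s, a) isT).
  have /andP[r0 _] := rwd01 xm.1 xm.2.
  have /andP[l _] := kernel_average_bounds xm.1 xm.2 fmaxF.
  have Fxm := q_opt xm.1 xm.2; rewrite -/(F xm) in Fxm.
  rewrite -(pmulr_rge0 _ g1); have := ler_wpM2l gamma_ge0 l; rewrite /=; lra.
apply: le_trans (FM (s, a) isT) _.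
have /andP[_ r1] := rwd01 xM.1 xM.2.
have /andP[_ u] := kernel_average_bounds xM.1 xM.2 fmaxF.
rewrite -[leRHS]mulr1 ler_pdivlMl //.
have FxM := q_opt xM.1 xM.2; rewrite -/(F xM) in FxM.
have := ler_wpM2l gamma_ge0 u; rewrite /=; lra.
Qed.

End Bellman.

(** * Linear noise recursions and their variance proxies *)

Section Noise.
Context {R : realType} {K : nat}.
Implicit Types (a : nat -> R) (b xi : nat -> 'I_K -> R).

(** One recursion serves both the averaged and the local noise, which differ only in the decay [a]
    and the gain [b]. *)
Fixpoint noise a b xi (t : nat) : R :=
  if t is t'.+1 then a t' * noise a b xi t' + \sum_k b t' k * xi t' k else 0.

(** The coefficient of [xi i k] after unrolling: the gain at time [i] damped by all later decays. It
    is deterministic, as Hoeffding's inequality requires. *)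
Fixpoint noise_weight a b (t i : nat) (k : 'I_K) : R :=
  if t is t'.+1 then if i == t' then b t' k else a t' * noise_weight a b t' i k
  else 0.

Lemma noiseE a b xi t :
  noise a b xi t = \sum_(i < t) \sum_k noise_weight a b t i k * xi i k.
Proof.
elim: t => [|t IHt] /=; first by rewrite big_ord0.
rewrite big_ord_recr /= eqxx; congr (_ + _).
rewrite IHt mulr_sumr; apply: eq_bigr => i _.
rewrite ltn_eqF // mulr_sumr.
by under [RHS]eq_bigr do rewrite -mulrA.
Qed.

Definition noise_variance a b (t : nat) : R :=
  \sum_(i < t) \sum_k noise_weight a b t i k ^+ 2.

Lemma noise_varianceS a b t :
  noise_variance a b t.+1 = a t ^+ 2 * noise_variance a b t + \sum_k b t k ^+ 2.
Proof.
rewrite /noise_variance big_ord_recr /= eqxx; congr (_ + _).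
rewrite mulr_sumr; apply: eq_bigr => i _.
rewrite ltn_eqF // mulr_sumr.
by under eq_bigr do rewrite exprMn.
Qed.

End Noise.

(** * Pathwise error bound, given bounds on the noise *)

Section Trajectory.
Context {R : realType} {S A : finType} (K E : nat) (gamma lambda : R).
Variables (rwd : S -> A -> R) (P : 'I_K -> S -> A -> S -> R).
Variables (Qstar Q0 : S -> A -> R).

Definition innovation (k : 'I_K) (s : S) (a : A) (s' : S) : R :=
  \sum_s'' P k s a s'' * fmax (Qstar s'') - fmax (Qstar s').

Definition avg_decay (t : nat) : R := 1 - lambda.
Definition avg_gain (t : nat) (k : 'I_K) : R := lambda * gamma / K%:R.

(* The local noise is reset at each synchronization. *)
Definition local_decay (t : nat) : R :=
  if (t.+1 %% E == 0)%N then 0 else 1 - lambda.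
Definition local_gain (k : 'I_K) (t : nat) (j : 'I_K) : R :=
  if (t.+1 %% E == 0)%N then 0 else lambda * gamma * (j == k)%:R.

Section Deterministic.
Hypotheses (A_gt0 : (0 < #|A|)%N) (K_gt0 : (0 < K)%N) (E_gt0 : (0 < E)%N).
Hypotheses (gamma_gt0 : 0 < gamma) (gamma_lt1 : gamma < 1).
Hypotheses (lambda_gt0 : 0 < lambda) (lambda_le1 : lambda <= 1).
Hypothesis period_le1 : lambda * (E%:R - 1) <= 1.
Hypothesis period_small : gamma * (lambda * (E%:R - 1)) <= (1 - gamma) / 4.
Hypothesis Qstar_opt : bellman_optimal gamma rwd (avg_kernel P) Qstar.
Variable x : nat -> 'I_K -> S -> A -> S.
Variables (L M N : R) (T : nat).
Hypotheses (L_ge0 : 0 <= L) (M_ge0 : 0 <= M) (N_ge0 : 0 <= N).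
Hypothesis bias_le : forall k s a,
  `|\sum_s' avg_kernel P s a s' * fmax (Qstar s')
    - \sum_s' P k s a s' * fmax (Qstar s')| <= M.
Hypothesis init_le : forall s a, `|Qstar s a - Q0 s a| <= L.

Local Notation Q := (fedQ E gamma lambda rwd Q0 x).
Local Notation Qbar := (fedQ_avg E gamma lambda rwd Q0 x).
Local Notation xi s a := (fun t k => innovation k s a (x t k s a)).
Local Notation Wbar t s a := (noise avg_decay avg_gain (xi s a) t).
Local Notation W t k s a := (noise local_decay (local_gain k) (xi s a) t).

Hypothesis Wbar_le : forall t s a, (t <= T)%N -> `|Wbar t s a| <= N.
Hypothesis W_le : forall t k s a, (t <= T)%N -> `|W t k s a| <= N.

(** Half of the contraction margin [1 - gamma] goes into the decay rate; the other half pays for the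
    delay in [rho_delay]. *)
Let rho := 1 - (1 - gamma) / 2 * lambda.
(** Bounds local drift plus local noise within a period. The factor 4/3 makes bias and noise fill
    [3/4 c]; the feedback of [c] on itself takes at most the remaining quarter, by
    [period_small]. *)
Let c := 4 / 3 * ((E%:R - 1) * (lambda * gamma * M) + N).
(** Growth of the local error bound per unsynchronized step. *)
Let alpha := lambda * gamma * (M + c).
(** The stationary level, solving [N + gamma (B + c) = B]. *)
Let B := (N + gamma * c) / (1 - gamma).
Let zb t := L * rho ^+ t + B.

Let lambda_ge0 : 0 <= lambda := ltW lambda_gt0.
Let gamma_ge0 : 0 <= gamma := ltW gamma_gt0.

Let E1 : 0 <= E%:R - 1 :> R.
Proof. by rewrite subr_ge0 ler1n. Qed.

Let c_ge0 : 0 <= c.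
Proof. by rewrite mulr_ge0 ?divr_ge0 ?addr_ge0 ?mulr_ge0. Qed.

Let alpha_ge0 : 0 <= alpha.
Proof. by rewrite !mulr_ge0 ?addr_ge0 // ltW. Qed.

Let B_ge0 : 0 <= B.
Proof.
apply: divr_ge0; last by rewrite subr_ge0 ltW.
by apply: addr_ge0 => //; apply: mulr_ge0.
Qed.

Let BE : N + gamma * (B + c) = B.
Proof. by rewrite /B; field; rewrite subr_eq0 gt_eqF. Qed.

Let drift_le : (E%:R - 1) * alpha + N <= c.
Proof.
have : (E%:R - 1) * (lambda * gamma * c) <= (1 - gamma) / 4 * c.
  have -> : (E%:R - 1) * (lambda * gamma * c)
      = gamma * (lambda * (E%:R - 1)) * c by ring.
  by rewrite ler_wpM2r.
have -> : (E%:R - 1) * alpha = (E%:R - 1) * (lambda * gamma * M)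
    + (E%:R - 1) * (lambda * gamma * c) by rewrite /alpha; ring.
have : (E%:R - 1) * (lambda * gamma * M) + N = 3 / 4 * c by rewrite /c; field.
have := mulr_ge0 gamma_ge0 c_ge0; lra.
Qed.

Let rho_gt0 : 0 < rho.
Proof.
have := mulr_ge0 gamma_ge0 lambda_ge0; rewrite /rho; move: lambda_le1; lra.
Qed.

(** At most [E - 1] steps have passed since the last synchronization, so Bernoulli's inequality and
    [lambda (E - 1) <= 1] bound the decay lost to the delay by the factor [1 - (1 - gamma) / 2]. *)
Let rho_delay t :
  gamma * rho ^+ (t %/ E * E) <= (1 - (1 - gamma) / 2) * rho ^+ t.
Proof.
rewrite {2}(divn_eq t E) exprD mulrCA [leLHS]mulrC.
rewrite ler_wpM2l ?exprn_ge0 ?(ltW rho_gt0) //.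
have bern j : 1 - j%:R * ((1 - gamma) / 2 * lambda) <= rho ^+ j.
  elim: j => [|j IHj]; first by rewrite expr0 mul0r subr0.
  rewrite exprS -natr1.
  apply: (@le_trans _ _ (rho * (1 - j%:R * ((1 - gamma) / 2 * lambda))));
    last by rewrite ler_wpM2l // ltW.
  have : 0 <= j%:R * ((1 - gamma) / 2 * lambda) * ((1 - gamma) / 2 * lambda).
    by rewrite !mulr_ge0 // ?divr_ge0 ?subr_ge0 // ltW.
  rewrite /rho; nra.
have jE : (t %% E)%:R <= E%:R - 1 :> R.
  by rewrite lerBrDr natr1 ler_nat ltn_mod.
have h : (t %% E)%:R * lambda <= 1.
  by apply: le_trans period_le1; rewrite mulrC ler_wpM2l // ltW.
(* With [e = (1 - gamma) / 2], [(1 - e)^2 = gamma + e^2 >= gamma]. *)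
apply: (@le_trans _ _ ((1 - (1 - gamma) / 2) * (1 - (1 - gamma) / 2))).
  by have := sqr_ge0 (1 - gamma); lra.
have eps0 : 0 <= (1 - gamma) / 2 by move: gamma_lt1; lra.
rewrite ler_wpM2l //; first by move: gamma_gt0; lra.
apply: le_trans (bern _); have := ler_wpM2l eps0 h; lra.
Qed.

(** Adding and subtracting the [P k] average of the optimal values and their sampled value splits
    one step into decay, heterogeneity bias, centered noise and feedback. *)
Let local_stepE (q : S -> A -> R) k (y : S -> A -> S) s a :
  Qstar s a - local_step gamma lambda rwd q y s a =
  (1 - lambda) * (Qstar s a - q s a)
  + lambda * gamma * (\sum_s' avg_kernel P s a s' * fmax (Qstar s')
                      - \sum_s' P k s a s' * fmax (Qstar s'))
  + lambda * gamma * innovation k s a (y s a)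
  + lambda * gamma * (fmax (Qstar (y s a)) - fmax (q (y s a))).
Proof. by rewrite /local_step /innovation {1}Qstar_opt [in RHS]Qstar_opt; ring. Qed.

(** The biases cancel over the agents, so heterogeneity reaches the averaged table only through the
    local drift. *)
Let avg_kernel_avg s a :
  \sum_k (\sum_s' avg_kernel P s a s' * fmax (Qstar s')
          - \sum_s' P k s a s' * fmax (Qstar s')) = 0.
Proof.
rewrite big_split /= sumr_const card_ord sumrN exchange_big /=.
rewrite -mulr_natl mulr_sumr -sumrB big1 // => s' _.
by rewrite /avg_kernel -mulr_suml !mulrA mulfV ?mul1r ?subrr // pnatr_eq0 -lt0n.
Qed.

Let invK_sum (r : R) : K%:R^-1 * \sum_(k < K) r = r.
Proof. by rewrite sumr_const card_ord -[r *+ K]mulr_natl mulKf // pnatr_eq0 -lt0n. Qed.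

(** Synchronizing preserves the mean, so the average obeys the same recursion at every step. *)
Let QbarS t s a : Qbar t.+1 s a =
  K%:R^-1 * \sum_j local_step gamma lambda rwd (Q t j) (x t j) s a.
Proof.
by rewrite /fedQ_avg /=; case: (_ == 0)%N; rewrite ?invK_sum.
Qed.

Let QbarE t s a : Qstar s a - Qbar t.+1 s a =
  (1 - lambda) * (Qstar s a - Qbar t s a)
  + \sum_k avg_gain t k * innovation k s a (x t k s a)
  + lambda * gamma * (K%:R^-1 * \sum_k
       (fmax (Qstar (x t k s a)) - fmax (Q t k (x t k s a)))).
Proof.
rewrite QbarS -[X in X - _ = _]invK_sum -mulrBr -sumrB.
under eq_bigr => k _ do rewrite (local_stepE _ k).
rewrite 3![in LHS]big_split /= /avg_gain -!mulr_sumr avg_kernel_avg.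
rewrite /fedQ_avg sumrB -[in RHS](invK_sum (Qstar s a)); ring.
Qed.

(** Both clauses are proved together: the averaged step uses the local errors, and a synchronization
    restarts the local errors from the averaged one. Local errors are compared with the envelope at
    the last synchronization [t %/ E * E]. *)
Let invariant t :=
  (forall k s a, `|Qstar s a - Q t k s a - W t k s a|
     <= zb (t %/ E * E) + (t %% E)%:R * alpha) /\
  (forall s a, `|Qstar s a - Qbar t s a - Wbar t s a|
     <= L * rho ^+ t + gamma * (B + c)).

Let invariant_local t k s a : (t <= T)%N -> invariant t ->
  `|Qstar s a - Q t k s a| <= zb (t %/ E * E) + c.
Proof.
move=> tT [inv _]; have := inv k s a; have := W_le k s a tT.
have : (t %% E)%:R * alpha <= (E%:R - 1) * alpha.
  by rewrite ler_wpM2r // lerBrDr natr1 ler_nat ltn_mod.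
rewrite !ler_norml => h1 /andP[h2 h3] /andP[h4 h5].
by have := drift_le; move=> h6; apply/andP; split; lra.
Qed.

Let invariant_avg t s a : (t <= T)%N -> invariant t ->
  `|Qstar s a - Qbar t s a| <= zb t.
Proof.
move=> tT [_ inv]; have := inv s a; have := Wbar_le s a tT.
have := BE; rewrite !ler_norml /zb => h1 /andP[h2 h3] /andP[h4 h5]; apply/andP; split; lra.
Qed.

Let invariant0 : invariant 0.
Proof.
split=> [k s a|s a] /=.
  rewrite subr0 div0n mod0n mul0n mul0r addr0 /zb expr0 mulr1.
  by apply: le_trans (init_le s a) _; rewrite lerDl.
rewrite subr0 /fedQ_avg /= invK_sum expr0 mulr1.
apply: le_trans (init_le s a) _.
by rewrite lerDl mulr_ge0 ?addr_ge0 // ltW.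
Qed.

Let avg_step t : (t <= T)%N -> invariant t -> forall s a,
  `|Qstar s a - Qbar t.+1 s a - Wbar t.+1 s a|
     <= L * rho ^+ t.+1 + gamma * (B + c).
Proof.
move=> tT inv s a; rewrite QbarE /= {1}/avg_decay.
set D := K%:R^-1 * _; set w := noise _ _ _ t.
have D_le : `|D| <= zb (t %/ E * E) + c.
  rewrite /D normrM ger0_norm ?invr_ge0 // -[leRHS]invK_sum.
  rewrite ler_wpM2l ?invr_ge0 //; apply: le_trans (ler_norm_sum _ _ _) _.
  apply: ler_sum => k _; apply: fmax_dist => // a'.
  exact: invariant_local.
clearbody D; rewrite (_ : _ - _ = (1 - lambda) * (Qstar s a - Qbar t s a - w)
    + lambda * gamma * D); last by ring.
apply: le_trans (ler_normD _ _) _; rewrite !normrM.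
rewrite (gtr0_norm lambda_gt0) (gtr0_norm gamma_gt0).
rewrite (ger0_norm (_ : 0 <= 1 - lambda)) ?subr_ge0 //.
have h1 : (1 - lambda) * `|Qstar s a - Qbar t s a - w|
    <= (1 - lambda) * (L * rho ^+ t + gamma * (B + c)).
  by rewrite ler_wpM2l ?subr_ge0 //; case: inv.
have h2 : lambda * gamma * `|D| <= lambda * gamma * (zb (t %/ E * E) + c).
  by rewrite ler_wpM2l ?mulr_ge0 // ltW.
apply: le_trans (lerD h1 h2) _.
(* The stationary parts match exactly, so only the transient remains to be compared, which is
   [rho_delay]. *)
have h3 : L * lambda * (gamma * rho ^+ (t %/ E * E))
    <= L * lambda * ((1 - (1 - gamma) / 2) * rho ^+ t).
  by rewrite ler_wpM2l ?rho_delay ?mulr_ge0 // ltW.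
rewrite exprS /zb -subr_ge0 {1}/rho.
rewrite (_ : _ - _ = L * lambda * ((1 - (1 - gamma) / 2) * rho ^+ t)
  - L * lambda * (gamma * rho ^+ (t %/ E * E))); last by ring.
by rewrite subr_ge0.
Qed.

Let W_sync t k s a : (t.+1 %% E == 0)%N = true -> W t.+1 k s a = 0.
Proof.
move=> sync; rewrite /= {1}/local_decay sync mul0r add0r big1 // => j _.
by rewrite /local_gain sync mul0r.
Qed.

Let W_nosync t k s a : (t.+1 %% E == 0)%N = false -> W t.+1 k s a =
  (1 - lambda) * W t k s a + lambda * gamma * innovation k s a (x t k s a).
Proof.
move=> nsync; rewrite /= {1}/local_decay nsync; congr (_ + _).
rewrite (bigD1 k) //= {1}/local_gain nsync eqxx mulr1 big1 ?addr0 //.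
by move=> j /negPf jk; rewrite /local_gain nsync jk mulr0 mul0r.
Qed.

Let local_step_le t : (t < T)%N -> invariant t -> forall k s a,
  `|Qstar s a - Q t.+1 k s a - W t.+1 k s a|
     <= zb (t.+1 %/ E * E) + (t.+1 %% E)%:R * alpha.
Proof.
move=> tT inv k s a.
have [sync|nsync] := boolP (t.+1 %% E == 0)%N.
  (* The local noise is now zero and the local table is the average; its noise [N] is absorbed in
     [zb] through [BE]. *)
  rewrite W_sync // (eqP sync) mul0r addr0 subr0 divnK //.
  have -> : Q t.+1 k s a = Qbar t.+1 s a by rewrite QbarS /= sync.
  have := avg_step (ltnW tT) inv s a; have := Wbar_le s a tT.
  have := BE; rewrite !ler_norml /zb => h1 /andP[h2 h3].
  move=> /andP[h4 h5]; apply/andP; split; lra.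
rewrite W_nosync ?(negPf nsync) //.
have -> : Q t.+1 k s a = local_step gamma lambda rwd (Q t k) (x t k) s a.
  by rewrite /= (negPf nsync).
rewrite (local_stepE _ k).
set w := noise _ _ _ t; set bias := \sum_s' _ - _; set D := fmax _ - _.
rewrite (_ : _ - _ = (1 - lambda) * (Qstar s a - Q t k s a - w)
    + lambda * gamma * bias + lambda * gamma * D); last by ring.
have lg0 : 0 <= lambda * gamma by rewrite mulr_ge0 // ltW.
have D_le : `|D| <= zb (t %/ E * E) + c.
  by apply: fmax_dist => // a'; apply: invariant_local (ltnW tT) inv.
rewrite modnS divnS // /dvdn (negPf nsync) add0n.
have := inv.1 k s a; rewrite -/w; have := bias_le k s a; rewrite -/bias => hb hw.
apply: le_trans (ler_normD _ _) _.
apply: le_trans (lerD (ler_normD _ _) (lexx _)) _.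
rewrite !normrM (gtr0_norm lambda_gt0) (gtr0_norm gamma_gt0).
rewrite (ger0_norm (_ : 0 <= 1 - lambda)) ?subr_ge0 //.
have h1 := ler_wpM2l (_ : 0 <= 1 - lambda) hw.
have h2 := ler_wpM2l lg0 hb.
have h3 := ler_wpM2l lg0 D_le.
apply: le_trans (lerD (lerD (h1 _) h2) h3) _; first by rewrite subr_ge0.
have z0 : 0 <= zb (t %/ E * E).
  by rewrite addr_ge0 // mulr_ge0 // exprn_ge0 // ltW.
(* Dropping the damping of the old drift and of the envelope leaves this nonnegative slack; the
   bound grows by exactly [alpha]. *)
rewrite -natr1 -subr_ge0 /alpha -/alpha.
rewrite (_ : _ - _ = lambda * ((t %% E)%:R * alpha)
   + lambda * (1 - gamma) * zb (t %/ E * E)); last by rewrite /alpha; ring.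
have ja : 0 <= (t %% E)%:R * alpha by apply: mulr_ge0.
have g1 : 0 <= 1 - gamma by rewrite subr_ge0 ltW.
by apply: addr_ge0; [exact: mulr_ge0|exact: mulr_ge0 (mulr_ge0 lambda_ge0 g1) z0].
Qed.

Lemma fedQ_avg_error s a : `|Qstar s a - Qbar T s a| <=
  L * (1 - (1 - gamma) / 2 * lambda) ^+ T
  + (N + gamma * (4 / 3 * ((E%:R - 1) * (lambda * gamma * M) + N)))
    / (1 - gamma).
Proof.
rewrite -/rho -/c -/B -/(zb T); apply: invariant_avg => //.
suff inv t : (t <= T)%N -> invariant t by apply: inv.
elim: t => [//|t IHt] tT; have inv := IHt (ltnW tT).
by split; [exact: local_step_le|exact: avg_step (ltnW tT) inv].
Qed.

End Deterministic.
End Trajectory.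

(** * Union bound and reduction to the finite product law *)

Lemma union_bound (R : realType) (F J : finType) (w : F -> R)
    (bad : J -> pred F) (D : pred F) (b : R) :
  (forall f, 0 <= w f) -> (forall f, D f -> exists j, bad j f) ->
  (forall j, \sum_(f | bad j f) w f <= b) ->
  \sum_(f | D f) w f <= #|J|%:R * b.
Proof.
move=> w0 Dbad badb.
apply: (@le_trans _ _ (\sum_j \sum_(f | bad j f) w f)); last first.
  apply: le_trans (ler_sum _ (fun j _ => badb j)) _.
  by rewrite sumr_const mulr_natl.
under [leRHS]eq_bigr do rewrite big_mkcond.
rewrite exchange_big big_mkcond /=; apply: ler_sum => f _.
have nonneg j : 0 <= if bad j f then w f else 0 by case: ifP.
case: ifPn => [/Dbad[j badj]|_]; last exact: sumr_ge0.
by rewrite (bigD1 j) //= badj lerDl sumr_ge0.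
Qed.

Section JointLaw.
Context {R : realType} {d : measure_display} {Omega : measurableType d}.
Variable Pr : probability Omega R.
Context {I S : finType} (X : I -> Omega -> S) (p : I -> S -> R).
Hypothesis X_rv : forall i, discrete_rv (X i).
Hypothesis X_law : forall i, has_law Pr (X i) (p i).
Hypothesis X_indep : mutually_independent Pr X.

(** The intersection runs over the full index set so that independence applies to it directly. *)
Let atom (f : {ffun I -> S}) : set Omega :=
  \bigcap_(i in [set` [set: I]%SET]) (X i @^-1` [set f i]).

Let atomP f w : atom f w <-> [ffun i => X i w] = f.
Proof.
split=> [fw|<- i _ /=]; last by rewrite ffunE.
by apply/ffunP => i; rewrite ffunE; apply: fw; rewrite /= inE.
Qed.

Let measurable_atom f : measurable (atom f).
Proof.
apply: fin_bigcap_measurable; first exact: finite_finset.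
by move=> i _; apply: X_rv.
Qed.

Let Pr_atom f : Pr (atom f) = (prod_weight p f)%:E.
Proof.
rewrite /atom X_indep -prodEFin big_mkcond.
by apply: eq_bigr => i _; rewrite inE X_law.
Qed.

(** The event is a finite disjoint union of atoms, each fixing every sample. *)
Lemma joint_law (G : {set {ffun I -> S}}) :
  Pr [set w | [ffun i => X i w] \in G] = (\sum_(f in G) prod_weight p f)%:E.
Proof.
have -> : [set w | [ffun i => X i w] \in G] = \bigcup_(f in [set` G]) atom f.
  apply/seteqP; split=> [w Gw|w [f /= Gf /atomP fw]] /=; last by rewrite fw.
  by exists [ffun i => X i w] => //; apply/atomP.
rewrite measure_fin_bigcup.
- have -> : [set` G] = [set` enum G].
    by apply/seteqP; split=> f /=; rewrite mem_enum.
  rewrite -fsbig_seq ?enum_uniq // big_enum /= -sumEFin.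
  by apply: eq_bigr => f _; apply: Pr_atom.
- exact: finite_finset.
- by move=> f g _ _ [w [/atomP <- /atomP <-]].
- by move=> f _.
Qed.

End JointLaw.

(** Allows the infinite sample sequence to be replaced by a finite table of the first [T] rounds. *)
Lemma fedQ_ext (R : realType) (S A : finType) (K E : nat) (gamma lambda : R)
    (rwd Q0 : S -> A -> R) (x y : nat -> 'I_K -> S -> A -> S) (t : nat) :
  (forall u, (u < t)%N -> x u = y u) ->
  fedQ E gamma lambda rwd Q0 x t = fedQ E gamma lambda rwd Q0 y t.
Proof.
elim: t => [//|t IHt] xy; apply/funext => k /=.
by rewrite xy // IHt // => u ut; apply: xy; rewrite ltnS ltnW.
Qed.

(** * Tail bound for the noise of one state-action pair *)

Section Concentration.
Context {R : realType} {S A : finType} {K T : nat}.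
Variables (P : 'I_K -> S -> A -> S -> R) (Qstar : S -> A -> R) (L : R).
Hypothesis T_gt0 : (0 < T)%N.
Hypothesis P_kernel : forall k, transition_kernel (P k).
Hypothesis A_gt0 : (0 < #|A|)%N.
Hypothesis Qstar_bounds : forall s a, 0 <= Qstar s a <= L.

Local Notation index := ('I_T * 'I_K * S * A)%type.

(* Junk value for t >= T, which the first T iterations never read. *)
Definition trajectory (f : {ffun index -> S}) (t : nat) (k : 'I_K)
    (s : S) (a : A) : S := f (insubd (Ordinal T_gt0) t, k, s, a).

Definition sample_law (i : index) : S -> R := P i.1.1.2 i.1.2 i.2.

Local Notation innov := (innovation P Qstar).

Lemma innovation_mean k s a : \sum_s' P k s a s' * innov k s a s' = 0.
Proof.
under eq_bigr do rewrite mulrBr.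
by rewrite sumrB -mulr_suml (P_kernel k s a).2 mul1r subrr.
Qed.

(** Mean and sampled value both lie in [[0, L]], hence [L] rather than [2 L]. *)
Lemma innovation_le k s a s' : `|innov k s a s'| <= L.
Proof.
have V_bounds s'' : 0 <= fmax (Qstar s'') <= L.
  have [a0 _] := card_gt0P A_gt0; apply/andP; split.
    by apply: le_trans (fmax_ge _ a0); case/andP: (Qstar_bounds s'' a0).
  by apply: fmax_le => // a'; case/andP: (Qstar_bounds s'' a').
have := V_bounds s'.
have := kernel_average_bounds (P_kernel k) s a V_bounds.
by rewrite ler_norml /innovation => /andP[h1 h2] /andP[h3 h4];
  apply/andP; split; lra.
Qed.

Lemma trajectoryE (f : {ffun index -> S}) (i : index) :
  trajectory f i.1.1.1 i.1.1.2 i.1.2 i.2 = f i.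
Proof. by case: i => [[[t k] s] a]; rewrite /trajectory /= valKd. Qed.

Lemma sum_index (H : nat -> 'I_K -> S -> A -> R) (t : nat) s a : (t <= T)%N ->
  \sum_(i : index | [&& (i.1.1.1 < t)%N, i.1.2 == s & i.2 == a])
     H i.1.1.1 i.1.1.2 i.1.2 i.2
  = \sum_(u < t) \sum_k H u k s a.
Proof.
move=> tT; rewrite (big_ord_widen T (fun u => \sum_k H u k s a) tT).
rewrite pair_big /=.
under [RHS]eq_bigr => i _ do
  rewrite -(@big_pred1_eq R 0 +%R S s (fun s' => H i.1 i.2 s' a)).
rewrite pair_big /=.
under [RHS]eq_bigr => i _ do
  rewrite -(@big_pred1_eq R 0 +%R A a (fun a' => H i.1.1 i.1.2 i.2 a')).
rewrite pair_big /=.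
by apply: eq_bigl => i; rewrite andbT andbA.
Qed.

Lemma noise_tail (decay : nat -> R) (gain : nat -> 'I_K -> R) (v eps : R)
    (t : nat) (s : S) (a : A) :
  (t <= T)%N -> noise_variance decay gain t <= v ->
  0 < L -> 0 < v -> 0 < eps ->
  \sum_(f : {ffun index -> S} |
     eps < `|noise decay gain (fun u k => innov k s a (trajectory f u k s a)) t|)
     prod_weight sample_law f
  <= 2 * expR (- (eps ^+ 2 / (8 * (v * L ^+ 2)))).
Proof.
move=> tT wv L0 v0 eps0.
(* Samples of other pairs or of times from [t] on get coefficient zero, which makes the noise a
   linear form over the whole index set. *)
pose sel (i : index) := [&& (i.1.1.1 < t)%N, i.1.2 == s & i.2 == a].
pose wt (i : index) := noise_weight decay gain t i.1.1.1 i.1.1.2.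
pose g i s' := if sel i then wt i * innov i.1.1.2 i.1.2 i.2 s' else 0.
pose c i := if sel i then `|wt i| * L else 0.
have noise_sum f : noise decay gain
    (fun u k => innov k s a (trajectory f u k s a)) t = \sum_i g i (f i).
  rewrite noiseE -big_mkcond -(sum_index (fun u k s a =>
    noise_weight decay gain t u k * innov k s a (trajectory f u k s a)) s a tT).
  by apply: eq_bigr => i _; rewrite trajectoryE.
under eq_bigl do rewrite noise_sum.
apply: (@hoeffding _ _ _ _ _ _ g c) => //.
- by move=> i s'; rewrite (P_kernel _ _ _).1.
- by move=> i; rewrite (P_kernel _ _ _).2.
- move=> i; rewrite /g; case: (sel i); last first.
    by rewrite big1 // => s' _; rewrite mulr0.
  under eq_bigr do rewrite mulrCA.
  by rewrite -mulr_sumr innovation_mean mulr0.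
- move=> i s'; rewrite /g /c; case: (sel i); last by rewrite normr0.
  by rewrite normrM ler_wpM2l // innovation_le.
- apply: (@le_trans _ _ (noise_variance decay gain t * L ^+ 2)); last first.
    by rewrite ler_wpM2r // sqr_ge0.
  rewrite /noise_variance mulr_suml.
  under [leRHS]eq_bigr do rewrite mulr_suml.
  rewrite -(sum_index (fun u k _ _ =>
    noise_weight decay gain t u k ^+ 2 * L ^+ 2) s a tT) [leRHS]big_mkcond /=.
  apply: ler_sum => i _; rewrite /c /sel; case: ifP => _.
    by rewrite exprMn real_normK ?num_real.
  by rewrite expr0n.
- by rewrite mulr_gt0 // exprn_gt0.
Qed.

End Concentration.

(** * Variance proxies of averaged and local noise *)

Section Variance.
Context {R : realType} {K : nat}.
Variables (E : nat) (gamma lambda : R).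
Hypotheses (K_gt0 : (0 < K)%N) (lambda_ge0 : 0 <= lambda) (lambda_le1 : lambda <= 1).

(** The bound is preserved by the variance recursion, with slack
    [gamma^2 lambda^2 (1 - lambda) / K]. *)
Lemma avg_variance_le t :
  noise_variance (avg_decay lambda) (@avg_gain R K gamma lambda) t
    <= gamma ^+ 2 * lambda / K%:R.
Proof.
elim: t => [|t IHt].
  by rewrite /noise_variance big_ord0 divr_ge0 // mulr_ge0 // sqr_ge0.
rewrite noise_varianceS /avg_gain sumr_const card_ord /avg_decay.
apply: le_trans (lerD (ler_wpM2l (sqr_ge0 _) IHt) (lexx _)) _.
have K0 : K%:R != 0 :> R by rewrite pnatr_eq0 -lt0n.
rewrite -subr_ge0 -[_ *+ K]mulr_natl.
rewrite (_ : _ - _ = gamma ^+ 2 / K%:R * lambda ^+ 2 * (1 - lambda)); last by field.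
rewrite mulr_ge0 ?subr_ge0 // mulr_ge0 ?sqr_ge0 //.
by rewrite divr_ge0 ?sqr_ge0.
Qed.

(** Since the last reset at most [E - 1] samples have entered, each with weight at most
    [lambda gamma]. *)
Lemma local_variance_le (k : 'I_K) t : (0 < E)%N ->
  noise_variance (local_decay E lambda) (local_gain E gamma lambda k) t
    <= (E%:R - 1) * (lambda * gamma) ^+ 2.
Proof.
move=> E_gt0.
apply: (@le_trans _ _ ((t %% E)%:R * (lambda * gamma) ^+ 2)); last first.
  by rewrite ler_wpM2r ?sqr_ge0 // lerBrDr natr1 ler_nat ltn_mod.
elim: t => [|t IHt]; first by rewrite /noise_variance big_ord0 mod0n mul0r.
rewrite noise_varianceS /local_decay /local_gain.
have [sync|nsync] := boolP (t.+1 %% E == 0)%N.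
  rewrite expr0n mul0r add0r big1 //.
  by rewrite mulr_ge0 // sqr_ge0.
rewrite (bigD1 k) //= eqxx mulr1 big1 ?addr0; last first.
  by move=> j /negPf ->; rewrite mulr0 expr0n.
rewrite modnS /dvdn (negPf nsync) -natr1 mulrDl mul1r lerD2r.
apply: le_trans IHt; rewrite ler_piMl //.
  by apply: sumr_ge0 => u _; apply: sumr_ge0 => j _; apply: sqr_ge0.
by rewrite exprn_ile1 ?subr_ge0 // lerBlDr lerDl.
Qed.

End Variance.

(** * Numerical comparison with the stated bound *)

Section Constants.
Context {R : realType} (gamma lambda : R).
Hypotheses (gamma_gt0 : 0 < gamma) (gamma_lt1 : gamma < 1).
Hypotheses (lambda_gt0 : 0 < lambda) (lambda_le1 : lambda <= 1).
Let L := (1 - gamma)^-1.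

Let g1 : 0 < 1 - gamma. Proof. by rewrite subr_gt0. Qed.

Let L_ge1 : 1 <= L.
Proof. by rewrite invf_ge1 // lerBlDr lerDl ltW. Qed.

Lemma transient_le (T : nat) :
  L * (1 - (1 - gamma) / 2 * lambda) ^+ T <=
  4 / (1 - gamma) ^+ 2
    * expR (- (2^-1 * Num.sqrt ((1 - gamma) * lambda * T%:R))).
Proof.
set y := (1 - gamma) * lambda * T%:R; set r := 2^-1 * _.
have y0 : 0 <= y by rewrite !mulr_ge0 // ltW.
have rE : r ^+ 2 = y / 4 by rewrite /r exprMn sqr_sqrtr //; field.
have pow_le : (1 - (1 - gamma) / 2 * lambda) ^+ T <= expR (- (y / 2)).
  have -> : - (y / 2) = T%:R * - ((1 - gamma) / 2 * lambda) by rewrite /y; field.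
  rewrite expRM_natl lerXn2r ?nnegrE ?expR_ge0 ?expR_ge1Dx //.
  rewrite subr_ge0; apply: le_trans (_ : (1 - gamma) / 2 * 1 <= 1).
    by rewrite ler_wpM2l // divr_ge0 // ltW.
  by move: gamma_gt0; lra.
(* r <= 2 r^2 + 1/8 *)
have exp_le : expR (- (y / 2)) <= 4 * expR (- r).
  apply: (@le_trans _ _ (expR (8^-1 - r))).
    rewrite ler_expR; have := sqr_ge0 (r - 4^-1); lra.
  rewrite expRD ler_wpM2r ?expR_ge0 //.
  rewrite -[8^-1]opprK expRN -[leRHS]invrK lef_pV2 ?posrE ?expR_gt0 ?invr_gt0 //.
  by apply: le_trans (expR_ge1Dx _); lra.
(* The second factor [L >= 1] is simply given away. *)
have -> : 4 / (1 - gamma) ^+ 2 * expR (- r) = L * (L * (4 * expR (- r))).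
  by rewrite /L; field; rewrite gt_eqF.
rewrite ler_wpM2l ?(le_trans _ L_ge1) //.
apply: le_trans pow_le (le_trans exp_le _).
by rewrite ler_peMl // mulr_ge0 ?expR_ge0.
Qed.

(** With noise level [4 gamma L q], the coefficients of [L^2] times bias and [L^2 q] are 4/3 and at
    most [4 + 16/3], below 14 and 16. *)
Lemma stationary_le (e kappa q : R) : 0 <= e -> 0 <= kappa -> 0 <= q ->
  (4 * gamma * L * q + gamma * (4 / 3 * (e * (lambda * gamma * (kappa * L))
    + 4 * gamma * L * q))) / (1 - gamma)
  <= 14 * gamma ^+ 2 / (1 - gamma) ^+ 2 * lambda * e * kappa
     + 16 / (1 - gamma) ^+ 2 * q.
Proof.
move=> e0 k0 q0.
have L2q : 0 <= L ^+ 2 * q by rewrite mulr_ge0 // sqr_ge0.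
have bias : 0 <= L ^+ 2 * (gamma ^+ 2 * lambda * e * kappa).
  rewrite mulr_ge0 ?sqr_ge0 // mulr_ge0 // mulr_ge0 // mulr_ge0 ?sqr_ge0 //.
  exact: ltW.
have gq : gamma * (L ^+ 2 * q) <= L ^+ 2 * q by rewrite ler_piMl // ltW.
have ggq : gamma * (gamma * (L ^+ 2 * q)) <= L ^+ 2 * q.
  by apply: le_trans (ler_wpM2l (ltW gamma_gt0) gq) gq.
have -> : 14 * gamma ^+ 2 / (1 - gamma) ^+ 2 * lambda * e * kappa
    = 14 * (L ^+ 2 * (gamma ^+ 2 * lambda * e * kappa)).
  by rewrite /L; field; rewrite gt_eqF.
have -> : 16 / (1 - gamma) ^+ 2 * q = 16 * (L ^+ 2 * q).
  by rewrite /L; field; rewrite gt_eqF.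
rewrite -/L; have -> : (4 * gamma * L * q + gamma * (4 / 3 * (e *
    (lambda * gamma * (kappa * L)) + 4 * gamma * L * q))) * L =
  4 * (gamma * (L ^+ 2 * q)) + 16 / 3 * (gamma * (gamma * (L ^+ 2 * q)))
    + 4 / 3 * (L ^+ 2 * (gamma ^+ 2 * lambda * e * kappa)) by field.
by lra.
Qed.

End Constants.

(** * Assembly: good event, tail exponents and union bound *)

Theorem theorem1 (R : realType) (S A : finType)
  (S_gt0 : (0 < #|S|)%N) (A_gt0 : (0 < #|A|)%N)
  (K E T : nat) (K_gt0 : (0 < K)%N) (E_gt0 : (0 < E)%N) (T_gt0 : (0 < T)%N)
  (gamma : R) (gamma_gt0 : 0 < gamma) (gamma_lt1 : gamma < 1)
  (lambda : R) (lambda_gt0 : 0 < lambda)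
  (rwd : S -> A -> R) (rwd01 : forall s a, 0 <= rwd s a <= 1)
  (P : 'I_K -> S -> A -> S -> R)
  (P_kernel : forall k, transition_kernel (P k))
  (Qstar : S -> A -> R)
  (Qstar_opt : bellman_optimal gamma rwd (avg_kernel P) Qstar)
  (Q0 : S -> A -> R) (Q0_bounds : forall s a, 0 <= Q0 s a <= (1 - gamma)^-1)
  (d : measure_display) (Omega : measurableType d) (Pr : probability Omega R)
  (X : nat -> 'I_K -> S -> A -> Omega -> S)
  (X_rv : forall (t : nat) (k : 'I_K) (s : S) (a : A),
    (t < T)%N -> discrete_rv (X t k s a))
  (X_law : forall (t : nat) (k : 'I_K) (s : S) (a : A),
    (t < T)%N -> has_law Pr (X t k s a) (P k s a))
  (X_indep : mutually_independent Pr
    (fun i : 'I_T * 'I_K * S * A => X i.1.1.1 i.1.1.2 i.1.2 i.2))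
  (E_small : E%:R - 1 <=
    lambda^-1 * Num.min ((1 - gamma) / (4 * gamma)) (K%:R^-1))
  (lambda_small : lambda <= E%:R^-1)
  (delta : R) (delta_gt0 : 0 < delta) (delta_lt : delta < 3^-1) :
  ((1 - 3 * delta)%:E <=
   Pr [set w |
     (norm_infty (fun s a =>
        Qstar s a -
        fedQ_avg E gamma lambda rwd Q0 (fun t k s a => X t k s a w) T s a)
      <= 4 / (1 - gamma) ^+ 2
           * expR (- (2^-1 * Num.sqrt ((1 - gamma) * lambda * T%:R)))
         + 14 * gamma ^+ 2 / (1 - gamma) ^+ 2
           * lambda * (E%:R - 1) * heterogeneity P
         + 16 / (1 - gamma) ^+ 2
           * Num.sqrt (lambda / K%:R
               * ln ((#|S|%:R * #|A|%:R * K%:R * T%:R) / delta)))%R])%E.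
Proof.
set L := (1 - gamma)^-1; set SAKT := #|S|%:R * #|A|%:R * K%:R * T%:R.
set ell := ln (SAKT / delta); set q := Num.sqrt (lambda / K%:R * ell).
set kappa := heterogeneity P; set bound := (_ + _ + _)%R.
have g1 : 0 < 1 - gamma by rewrite subr_gt0.
have L_gt0 : 0 < L by rewrite invr_gt0.
have K_gt0' : 0 < K%:R :> R by rewrite ltr0n.
have E_ge1 : 1 <= E%:R :> R by rewrite ler1n.
have lambda_le1 : lambda <= 1.
  by apply: le_trans lambda_small _; rewrite invf_le1 // (lt_le_trans ltr01).
have SAKT_ge1 : 1 <= SAKT.
  by rewrite /SAKT -!natrM ler1n !muln_gt0 S_gt0 A_gt0 K_gt0.
have SAKT_gt0 : 0 < SAKT by apply: lt_le_trans SAKT_ge1.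
have ell_gt0 : 0 < ell.
  rewrite ln_gt0 // ltr_pdivlMr // mul1r; apply: lt_le_trans SAKT_ge1.
  by apply: lt_trans delta_lt _; rewrite invf_lt1 // ltr1n.
have q2 : q ^+ 2 = lambda / K%:R * ell.
  by rewrite sqr_sqrtr // mulr_ge0 ?divr_ge0 ?ltW.
have q_gt0 : 0 < q by rewrite sqrtr_gt0 mulr_gt0 ?divr_gt0.
have period_le (u : R) : Num.min ((1 - gamma) / (4 * gamma)) K%:R^-1 <= u ->
    lambda * (E%:R - 1) <= u.
  by apply: le_trans; rewrite -ler_pdivlMl.
have period_K : lambda * (E%:R - 1) <= K%:R^-1.
  by apply: period_le; rewrite ge_min lexx orbT.
have period_le1 : lambda * (E%:R - 1) <= 1.
  by apply: le_trans period_K _; rewrite invf_le1 // ler1n.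
have period_small : gamma * (lambda * (E%:R - 1)) <= (1 - gamma) / 4.
  rewrite mulrC -ler_pdivlMr // (_ : _ / _ / _ = (1 - gamma) / (4 * gamma)).
    by apply: period_le; rewrite ge_min lexx.
  by field; rewrite gt_eqF.
have kappa_ge0 : 0 <= kappa by apply: bigmax_ge_id.
have Pbar_kernel : transition_kernel (avg_kernel P).
  move=> s a; split=> [s'|].
    rewrite mulr_ge0 ?invr_ge0 // sumr_ge0 // => k _.
    by have [->] := P_kernel k s a.
  rewrite -mulr_sumr exchange_big /=.
  under eq_bigr => k _ do rewrite (P_kernel k s a).2.
  by rewrite sumr_const card_ord mulVf // gt_eqF.
have Qstar_bounds s a : 0 <= Qstar s a <= L.
  exact: (bellman_optimal_bounds S_gt0 A_gt0 (ltW gamma_gt0) gamma_lt1 rwd01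
    Pbar_kernel Qstar_opt).
have init_le s a : `|Qstar s a - Q0 s a| <= L.
  have /andP[a1 a2] := Qstar_bounds s a; have /andP[b1 b2] := Q0_bounds s a.
  by rewrite -/L in b2; rewrite ler_norml; apply/andP; split; lra.
have bias_le k s a : `|\sum_s' avg_kernel P s a s' * fmax (Qstar s')
    - \sum_s' P k s a s' * fmax (Qstar s')| <= kappa * L.
  rewrite -sumrB.
  apply: le_trans (ler_norm_sum _ _ _) _.
  apply: (@le_trans _ _ (\sum_s' `|avg_kernel P s a s' - P k s a s'| * L)).
    apply: ler_sum => s' _; rewrite -mulrBl normrM ler_wpM2l //.
    have [a0 _] := card_gt0P A_gt0; rewrite ger0_norm.
      by apply: fmax_le => // a'; case/andP: (Qstar_bounds s' a').
    by apply: le_trans (fmax_ge _ a0); case/andP: (Qstar_bounds s' a0).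
  rewrite -mulr_suml ler_wpM2r ?(ltW L_gt0) //.
  exact: (le_bigmax 0 (fun x : 'I_K * S * A =>
    \sum_s' `|avg_kernel P x.1.2 x.2 s' - P x.1.1 x.1.2 x.2 s'|) (k, s, a)).
(* Chosen so that the tail exponent [N^2 / (8 v L^2)] with [v = gamma^2 lambda / K] is exactly
   [2 ell]. *)
pose N := 4 * gamma * L * q.
have N_gt0 : 0 < N by rewrite !mulr_gt0.
pose index := ('I_T * 'I_K * S * A)%type.
pose xf (f : {ffun index -> S}) := trajectory T_gt0 f.
pose err f s a := Qstar s a - fedQ_avg E gamma lambda rwd Q0 (xf f) T s a.
pose G := [set f | norm_infty (err f) <= bound]%SET.
have goalE : [set w | norm_infty (fun s a => Qstar s a -
    fedQ_avg E gamma lambda rwd Q0 (fun t k s a => X t k s a w) T s a) <= bound]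
  = [set w | [ffun i : index => X i.1.1.1 i.1.1.2 i.1.2 i.2 w] \in G].
  apply/seteqP; suff eq w : (fun s a => Qstar s a -
      fedQ_avg E gamma lambda rwd Q0 (fun t k s a => X t k s a w) T s a)
    = err [ffun i : index => X i.1.1.1 i.1.1.2 i.1.2 i.2 w].
    by split=> w /=; rewrite inE eq.
  apply/funext => s; apply/funext => a; rewrite /err /fedQ_avg.
  rewrite (@fedQ_ext _ _ _ _ _ _ _ _ _ _
    (xf [ffun i : index => X i.1.1.1 i.1.1.2 i.1.2 i.2 w])) // => u uT.
  apply/funext => k; apply/funext => s'; apply/funext => a'.
  by rewrite /xf /trajectory ffunE /= insubdK.
rewrite goalE (joint_law (p := sample_law P)) //; last first.
- by move=> i; apply: X_law.
- by move=> i; apply: X_rv.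
rewrite lee_fin.
pose w := prod_weight (sample_law P) : {ffun index -> S} -> R.
have law_ge0 (i : index) s : 0 <= sample_law P i s by rewrite (P_kernel _ _ _).1.
have w_ge0 f : 0 <= w f by apply: prod_weight_ge0.
have w_sum : \sum_f w f = 1.
  by apply: sum_prod_weight => i; rewrite (P_kernel _ _ _).2.
pose J := ('I_T * option 'I_K * S * A)%type.
(* None stands for the averaged noise, Some k for the local noise of agent k. *)
pose decay (o : option 'I_K) : nat -> R :=
  if o is Some _ then local_decay E lambda else avg_decay lambda.
pose gain (o : option 'I_K) : nat -> 'I_K -> R :=
  if o is Some k then local_gain E gamma lambda k else @avg_gain R K gamma lambda.
pose W (o : option 'I_K) (f : {ffun index -> S}) s a t := noise (decay o) (gain o)
  (fun u k => innovation P Qstar k s a (xf f u k s a)) t.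
(* The successor makes the times run over [1..T]; at time 0 the noise vanishes. *)
pose bad (j : J) (f : {ffun index -> S}) :=
  N < `|W j.1.1.2 f j.1.2 j.2 j.1.1.1.+1|.
have bad_ex f : f \notin G -> exists j, bad j f.
  apply: contraNP => /forallNP good; rewrite inE.
  have W_le o s a t : (t <= T)%N -> `|W o f s a t| <= N.
    case: t => [_|t tT]; first by rewrite /W /= normr0 ltW.
    by have := good (Ordinal tT, o, s, a); rewrite /bad /= => /negP; rewrite -leNgt.
  apply: bigmax_le => [|[s a] _].
    by rewrite /bound !addr_ge0 // !mulr_ge0 ?expR_ge0 ?invr_ge0 ?sqr_ge0
      ?subr_ge0 // ltW.
  rewrite /err /=.
  apply: le_trans (@fedQ_avg_error _ _ _ _ E gamma lambda rwd P Qstar Q0 A_gt0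
    K_gt0 E_gt0 gamma_gt0 gamma_lt1 lambda_gt0 lambda_le1 period_le1 period_small
    Qstar_opt (xf f) L (kappa * L) N T _ _ _ bias_le init_le _ _ s a) _.
  - exact: ltW.
  - by rewrite mulr_ge0 // ltW.
  - exact: ltW.
  - by move=> t s' a'; apply: (W_le None).
  - by move=> t k s' a'; apply: (W_le (Some k)).
  rewrite /bound -addrA lerD ?transient_le //.
  by apply: stationary_le; rewrite ?subr_ge0 // ltW.
have bad_le j : \sum_(f | bad j f) w f <= 2 * (delta / SAKT) ^+ 2.
  have var_le : noise_variance (decay j.1.1.2) (gain j.1.1.2) j.1.1.1.+1
      <= gamma ^+ 2 * lambda / K%:R.
    case: j.1.1.2 => [k|] /=; last by apply: avg_variance_le => //; apply: ltW.
    apply: le_trans (local_variance_le _ (ltW lambda_gt0) lambda_le1 _ _ E_gt0) _.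
    have gl_ge0 : 0 <= gamma ^+ 2 * lambda by rewrite mulr_ge0 ?sqr_ge0 // ltW.
    (* Here [lambda (E - 1) <= 1/K] brings the local proxy down to the averaged one. *)
    by have := ler_wpM2l gl_ge0 period_K; rewrite exprMn; lra.
  have v_gt0 : 0 < gamma ^+ 2 * lambda / K%:R by rewrite divr_gt0 ?mulr_gt0 ?exprn_gt0.
  apply: le_trans (noise_tail T_gt0 P_kernel A_gt0 Qstar_bounds j.1.2 j.2
    (ltn_ord j.1.1.1) var_le L_gt0 v_gt0 N_gt0) _.
  rewrite ler_wpM2l //.
  have -> : - (N ^+ 2 / (8 * (gamma ^+ 2 * lambda / K%:R * L ^+ 2))) = 2%:R * - ell.
    rewrite /N exprMn q2; field.
    by rewrite !gt_eqF.
  by rewrite expRM_natl expRN lnK ?posrE ?divr_gt0 // invf_div.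
have := union_bound w_ge0 bad_ex bad_le.
have Gsum : \sum_(f in G) w f = 1 - \sum_(f | f \notin G) w f.
  by apply/eqP; rewrite eq_sym subr_eq -w_sum (bigID (mem G)).
rewrite -/w Gsum lerD2l lerN2 => /le_trans; apply.
(* There are [T (K + 1) |S| |A|] bad events, and [K + 1 <= 2 K]. *)
have cardJ : #|{: J}|%:R <= 2 * SAKT.
  rewrite /J !card_prod card_option !card_ord /SAKT -!natrM ler_nat.
  rewrite (_ : (2 * _ = #|'I_T| * (K + K) * #|S| * #|A|)%N).
    by rewrite card_ord !leq_mul // -addn1 leq_add2l.
  by rewrite card_ord; ring.
have ratio_ge0 : 0 <= delta / SAKT by rewrite divr_ge0 ?ltW.
have ratio_le : delta / SAKT <= delta.
  by rewrite ler_pdivrMr // ler_peMr // ltW.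
(* The squared ratio cancels the number of events with a factor to spare: the total is at most
   [4 delta^2 <= 3 delta]. *)
apply: (@le_trans _ _ (2 * SAKT * (2 * (delta / SAKT) ^+ 2))).
  by rewrite ler_wpM2r // mulr_ge0 // sqr_ge0.
have -> : 2 * SAKT * (2 * (delta / SAKT) ^+ 2) = 4 * delta * (delta / SAKT).
  by field; rewrite gt_eqF.
apply: (@le_trans _ _ (4 * delta * delta)).
  by rewrite ler_wpM2l // mulr_ge0 // ltW.
by rewrite ler_wpM2r ?(ltW delta_gt0) //; move: delta_lt; lra.
Qed.
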